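(* Let $0<\beta<2$, let $r>2$ and $s\geq r+1$. Then the singular incompressible porous media (SIPM) equation on $\mathbb{T}^2\times[0,\infty)$, $$\partial_t\rho+\boldsymbol{v}\cdot\nabla\rho=0,\qquad \boldsymbol{v}=-\nabla(-\Delta)^{-1}\partial_{x_2}\Lambda^\beta\rho-(0,\Lambda^\beta\rho),$$ is locally Lipschitz $(H^r,H^s)$ ill-posed, i.e. it is not locally Lipschitz $(H^r,H^s)$ well-posed in the sense defined in the context.
   Context: Here $\Lambda=(-\Delta)^{1/2}$ is the Zygmund operator; equivalently $\boldsymbol{v}=\boldsymbol{R}^\perp R_1\Lambda^\beta\rho$, the Fourier multiplier with symbol $-k_1\boldsymbol{k}^\perp|\boldsymbol{k}|^{\beta-2}$ (with $\boldsymbol{k}^\perp=(-k_2,k_1)$), where $\boldsymbol{R}=(R_1,R_2)$ are the Riesz transforms. Definition: let $Y\subset X\subset L^2$ be Banach spaces. The initial value problem for the SIPM equation is called locally Lipschitz $(X,Y)$ well-posed if there exist continuous functions $T:[0,\infty)^2\to(0,\infty)$, non-increasing in both variables, and $K:[0,\infty)^2\to(0,\infty)$, non-decreasing in both variables, such that for every pair of initial data $\rho^{(1)}_0,\rho^{(2)}_0\in Y$ there exist unique solutions $\rho^{(1)},\rho^{(2)}\in L^\infty(0,T;X)$ of the SIPM initial value problem with these data, satisfying $\|\rho^{(1)}(\cdot,t)-\rho^{(2)}(\cdot,t)\|_X\leq K\|\rho^{(1)}_0-\rho^{(2)}_0\|_Y$ for every $t\in[0,T]$, where $T=T(\|\rho^{(1)}_0\|_Y,\|\rho^{(2)}_0\|_Y)$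 and $K=K(\|\rho^{(1)}_0\|_Y,\|\rho^{(2)}_0\|_Y)$. *)

(* Defs.v *)
(* Functions on the torus T^2 = (R/2piZ)^2 are
   represented by their Fourier coefficients, indexed by Z^2 = int * int;
   a complex coefficient is a pair (real part, imaginary part). *)
From HB Require Import structures.
From mathcomp Require Import all_boot all_order all_algebra.
From mathcomp Require Import all_classical all_reals all_analysis.
Set Implicit Arguments. Unset Strict Implicit. Unset Printing Implicit Defensive.
Import Order.TTheory GRing.Theory Num.Theory.
Import numFieldNormedType.Exports.
Local Open Scope classical_set_scope.
Local Open Scope ring_scope.

Section SIPM.
Variable R : realType.

Definition Z2 := (int * int)%type.

(* Fourier coefficients of a function on T^2: k |-> (Re rho_k, Im rho_k). *)
Definition coef := Z2 -> (R * R)%type.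

Definition kx (k : Z2) : R := k.1%:~R.
Definition ky (k : Z2) : R := k.2%:~R.
Definition ksq (k : Z2) : R := kx k ^+ 2 + ky k ^+ 2.

(* The Fourier coefficients are those of a real-valued function. *)
Definition real_coef (f : coef) : Prop :=
  forall k : Z2, (f (- k.1, - k.2)%R).1 = (f k).1 /\ (f (- k.1, - k.2)%R).2 = - (f k).2.

Definition csub (f g : coef) : coef := fun k => ((f k).1 - (g k).1, (f k).2 - (g k).2).

Definition Hs_norm2 (s : R) (f : coef) : \bar R :=
  (\esum_(k in [set: Z2]) ((1 + ksq k) `^ s * ((f k).1 ^+ 2 + (f k).2 ^+ 2))%:E)%E.

Definition in_Hs (s : R) (f : coef) : Prop :=
  real_coef f /\ (Hs_norm2 s f < +oo)%E.

Definition Hs_norm (s : R) (f : coef) : R := Num.sqrt (fine (Hs_norm2 s f)).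

(* Symbol of the velocity: v_hat(j) = m(j) rho_hat(j), with
   m(j) = -j1 j^perp |j|^(beta-2), j^perp = (-j2, j1), and m(0) = 0. *)
Definition msym (beta : R) (j : Z2) : (R * R)%type :=
  if j == (0, 0)%R then (0, 0)
  else (kx j * ky j * ksq j `^ ((beta - 2) / 2), - (kx j ^+ 2) * ksq j `^ ((beta - 2) / 2)).

Definition sqsum (g : Z2 -> R) (N : nat) : R :=
  \sum_(i < (2 * N).+1) \sum_(j < (2 * N).+1) g (i%:Z - N%:Z, j%:Z - N%:Z)%R.

(* Fourier coefficient k of the nonlinearity v . grad rho:
   sum_j i (k . m(j)) rho_j rho_{k-j}; summand written as (real, imag). *)
Definition nl_re (beta : R) (f : coef) (k : Z2) (j : Z2) : R :=
  let c := k.1%:~R * (msym beta j).1 + k.2%:~R * (msym beta j).2 in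
  let a := f j in let b := f (k.1 - j.1, k.2 - j.2)%R in
  c * (- (a.1 * b.2 + a.2 * b.1)).
Definition nl_im (beta : R) (f : coef) (k : Z2) (j : Z2) : R :=
  let c := k.1%:~R * (msym beta j).1 + k.2%:~R * (msym beta j).2 in
  let a := f j in let b := f (k.1 - j.1, k.2 - j.2)%R in
  c * (a.1 * b.1 - a.2 * b.2).

Definition NLre beta f k : R := limn (sqsum (nl_re beta f k)).
Definition NLim beta f k : R := limn (sqsum (nl_im beta f k)).

(* rho : [0,T] -> H^r is a solution of the SIPM initial value problem
   with datum rho0 on [0,T], in L^infty(0,T;H^r), in the (Duhamel / integral in
   time) sense: for every mode k and every t in [0,T],
     rho_k(t) = rho_k(0) - \int_0^t (v . grad rho)^_k(tau) dtau. *)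
Definition sipm_solution (beta r T : R) (rho0 : coef) (rho : R -> coef) : Prop :=
  rho 0 = rho0 /\
  (exists M : R, forall t, 0 <= t <= T -> in_Hs r (rho t) /\ Hs_norm r (rho t) <= M) /\
  (forall (k : Z2) (t : R), 0 <= t <= T ->
     (forall tau, 0 <= tau <= t ->
        cvgn (sqsum (nl_re beta (rho tau) k)) /\ cvgn (sqsum (nl_im beta (rho tau) k))) /\
     (lebesgue_measure).-integrable `[0%R, t]%classic (fun tau => (NLre beta (rho tau) k)%:E) /\
     (lebesgue_measure).-integrable `[0%R, t]%classic (fun tau => (NLim beta (rho tau) k)%:E) /\
     ((\int[lebesgue_measure]_(tau in `[0%R, t]%classic) (NLre beta (rho tau) k)%:E)
        = ((rho 0 k).1 - (rho t k).1)%:E)%E /\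
     ((\int[lebesgue_measure]_(tau in `[0%R, t]%classic) (NLim beta (rho tau) k)%:E)
        = ((rho 0 k).2 - (rho t k).2)%:E)%E).

Definition quadrant : set (R * R) := [set p | 0 <= p.1 /\ 0 <= p.2].

Definition loc_lip_wellposed (beta r s : R) : Prop :=
  exists (T K : R -> R -> R),
    {within quadrant, continuous (fun p : R * R => T p.1 p.2)} /\
    (forall a b, 0 <= a -> 0 <= b -> 0 < T a b) /\
    (forall a a' b b', 0 <= a <= a' -> 0 <= b <= b' -> T a' b' <= T a b) /\
    {within quadrant, continuous (fun p : R * R => K p.1 p.2)} /\
    (forall a b, 0 <= a -> 0 <= b -> 0 < K a b) /\
    (forall a a' b b', 0 <= a <= a' -> 0 <= b <= b' -> K a b <= K a' b') /\
    forall rho01 rho02 : coef, in_Hs s rho01 -> in_Hs s rho02 ->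
      let T0 := T (Hs_norm s rho01) (Hs_norm s rho02) in
      let K0 := K (Hs_norm s rho01) (Hs_norm s rho02) in
      exists rho1 rho2 : R -> coef,
        sipm_solution beta r T0 rho01 rho1 /\
        sipm_solution beta r T0 rho02 rho2 /\
        (forall rho', sipm_solution beta r T0 rho01 rho' ->
            forall t, 0 <= t <= T0 -> rho' t = rho1 t) /\
        (forall rho', sipm_solution beta r T0 rho02 rho' ->
            forall t, 0 <= t <= T0 -> rho' t = rho2 t) /\
        (forall t, 0 <= t <= T0 ->
            Hs_norm r (csub (rho1 t) (rho2 t)) <= K0 * Hs_norm s (csub rho01 rho02)).

End SIPM.

(* Main.v *)
Require Import Defs.
From HB Require Import structures.
From mathcomp Require Import all_boot all_order all_algebra.
From mathcomp Require Import all_classical all_reals all_analysis.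
From mathcomp Require Import zify ring lra.
Import Order.TTheory GRing.Theory Num.Theory.
Import numFieldNormedType.Exports.
Local Open Scope classical_set_scope.
Local Open Scope ring_scope.

(* Perturb the stationary state 2 sin(x_2) by a small wave 2 q cos(n x_1). If
   the problem were Lipschitz well-posed, the difference of the two solutions
   would be O(q), so that the nonlinearity contributes O(q^2) to each Fourier
   coefficient.  Writing x_m for the coefficient of the difference at (n, m)
   divided by q, this leaves the linearised chain
     x_m' = a_{m-1} x_{m-1} + a_{m+1} x_{m+1} + O(q),
     a_m = n^2 (n^2 + m^2)^((beta - 2) / 2) >= 0,   x_m(0) = [m = 0].
   The a_m are bounded in m, so that iterating Duhamel's formula from the a
   priori bound shows that the x_m are nonnegative up to o(1) as q -> 0.  Then
   x_0 and x_1 feed each other at rate about n^beta, and one of them exceeds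
   (c n^beta t)^i / i! for every i; with i large this beats the polynomial
   bound K (1 + n^2)^(s/2) as n -> oo. *)

(** * The perturbed linear chain *)

(** Duhamel's formula in its simplest form: monotonicity of the integral against the polynomial
    [c * x ^+ i - e], whose antiderivative is explicit. Only integrability is asked of [f], in
    keeping with the integral notion of solution. *)
Lemma integral_ge_monomial (R : realType) (f : R -> R) (t c e v : R) (i : nat) :
  0 <= t ->
  (lebesgue_measure).-integrable `[0%R, t]%classic (fun x => (f x)%:E) ->
  (\int[lebesgue_measure]_(x in `[0%R, t]%classic) (f x)%:E = v%:E)%E ->
  (forall x, 0 <= x <= t -> c * x ^+ i - e <= f x) ->
  c / i.+1%:R * t ^+ i.+1 - e * t <= v.
Proof.
(* The fundamental theorem of calculus is applied on a nondegenerate interval, so [t = 0] is settled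
   apart. *)
rewrite le_eqVlt => /predU1P[<-|t0] intf intv cf.
  move: intv; rewrite set_itv1 integral_set1 => -[<-].
  by rewrite expr0n /= !mulr0 subr0.
pose F (x : R) := c / i.+1%:R * x ^+ i.+1 - e * x.
have dF (x : R) : is_derive x (1:R) F (c * x ^+ i - e).
  rewrite (_ : F = (c / i.+1%:R) *: ((@id R) ^+ i.+1) - e *: (@id R)); last first.
    by apply/funext => y; rewrite /F fctE.
  apply: is_derive_eq.
  by rewrite /= /GRing.scale /= !mulr1 mulrA divfK // pnatr_eq0.
have cP : continuous (fun x : R => c * x ^+ i - e).
  by move=> x; apply: cvgB; [apply: cvgM; [exact: cvg_cst|exact: exprn_continuous]|exact: cvg_cst].
have cF : continuous F.
  by move=> x; apply: differentiable_continuous; apply/derivable1_diffP; apply: ex_derive.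
have F2 : (\int[lebesgue_measure]_(x in `[0%R, t]%classic) (c * x ^+ i - e)%:E
          = (F t)%:E - (F 0)%:E)%E.
  apply: continuous_FTC2 => //.
  - exact: continuous_subspaceT.
  - split.
    + by move=> x _; apply: ex_derive.
    + exact/cvg_at_right_filter/cF.
    + exact/cvg_at_left_filter/cF.
  - by move=> x _; rewrite derive1E; apply: derive_val.
have -> : c / i.+1%:R * t ^+ i.+1 - e * t = F t - F 0.
  by rewrite /F expr0n /= !mulr0 subrr subr0.
rewrite -lee_fin EFinB -F2 -intv; apply: le_integral => //.
- apply: (@continuous_compact_integrable R (fun x : R => c * x ^+ i - e)) => //.
    exact: segment_compact.
  exact: continuous_subspaceT.
- move=> x; rewrite inE /= in_itv /= => xt; rewrite lee_fin; exact: cf.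
Qed.

Section perturbed_chain.
Variables (R : realType) (T D A alpha : R) (a C : int -> R).

(* [G m] stands for the time derivative of [X m], which need not exist. *)
Definition perturbed_chain (eps : R) (X G : int -> R -> R) : Prop :=
  [/\ forall m, X m 0 = (m == 0)%:R,
      forall m t, 0 <= t <= T -> `|X m t| <= D &
      forall m t, 0 <= t <= T ->
        [/\ (lebesgue_measure).-integrable `[0%R, t]%classic (fun x => (G m x)%:E),
            (\int[lebesgue_measure]_(x in `[0%R, t]%classic) (G m x)%:E
              = (X m t - X m 0)%:E)%E &
            forall x, 0 <= x <= t ->
              `|G m x - (a (m - 1) * X (m - 1) x + a (m + 1) * X (m + 1) x)|
              <= C m * eps]].

(** A lower bound up to o(1) as [eps] tends to 0. The threshold is uniform over times and over all
    chains, so that bounds at different sites combine and the chain may be picked after the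
    threshold. *)
Definition asymp_ge (m : int) (F : R -> R) : Prop :=
  forall sigma, 0 < sigma -> exists2 eps0, 0 < eps0 &
    forall eps X G, 0 < eps <= eps0 -> perturbed_chain eps X G ->
      forall t, 0 <= t <= T -> F t - sigma <= X m t.

Hypothesis T0 : 0 < T.
Hypothesis a_ge0 : forall m, 0 <= a m.
Hypothesis a_le : forall m, a m <= A.

Lemma asymp_ge_weaken m (F F' : R -> R) :
  (forall t, 0 <= t <= T -> F' t <= F t) -> asymp_ge m F -> asymp_ge m F'.
Proof.
move=> FF' H sigma s0; have [e0 e00 He] := H _ s0; exists e0 => // eps X G He0 HX t tT.
by apply: le_trans (He _ _ _ He0 HX t tT); rewrite lerD2r FF'.
Qed.

(** One Duhamel iteration: as the rates are nonnegative, lower bounds at the two neighbours pass to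
    the derivative at [m] and are integrated. *)
Lemma asymp_ge_step m (c d : R) (i : nat) :
  asymp_ge (m - 1) (fun t => c * t ^+ i) ->
  asymp_ge (m + 1) (fun t => d * t ^+ i) ->
  asymp_ge m (fun t => (m == 0)%:R +
     (a (m - 1) * c + a (m + 1) * d) / i.+1%:R * t ^+ i.+1).
Proof.
move=> H1 H2 sigma s0.
have A0 : 0 <= A := le_trans (a_ge0 0) (a_le 0).
(* A positive majorant of [C m], whose sign is unknown; [eps <= q / C'] then makes the error at most
   [q]. *)
pose C' := `|C m| + 1.
have C'0 : 0 < C' by rewrite /C' ltr_wpDl.
(* The derivative loses at most [A * q] through each neighbour and [q] through the error term; over
   a time at most [T] this adds up to at most [sigma]. *)
pose q := sigma / ((2 * A + 1) * T).
have AT : 0 < (2 * A + 1) * T by apply: mulr_gt0 => //; lra.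
have q0 : 0 < q by apply: divr_gt0.
have [e1 e10 He1] := H1 _ q0.
have [e2 e20 He2] := H2 _ q0.
exists (Num.min (q / C') (Num.min e1 e2)).
  by rewrite !lt_min e10 e20 divr_gt0.
move=> eps X G; rewrite !le_min => /and4P[eps0 eC ee1 ee2] HX t tT.
have h1 := He1 _ _ _ _ HX; rewrite eps0 ee1 in h1.
have h2 := He2 _ _ _ _ HX; rewrite eps0 ee2 in h2.
have [X0 XD XI] := HX.
have [iG IG GX] := XI m t tT.
have /andP[t0 tT'] := tT.
suff : (a (m - 1) * c + a (m + 1) * d) / i.+1%:R * t ^+ i.+1 - (2 * A + 1) * q * t
   <= X m t - X m 0.
  rewrite X0.
  have : (2 * A + 1) * q * t <= sigma.
    have -> : sigma = (2 * A + 1) * q * T.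
      by rewrite /q; field; rewrite (gt_eqF T0) /=; lra.
    by rewrite ler_wpM2l // mulr_ge0 ?(ltW q0) //; lra.
  move: (_ / _ * _) (_ * q * t) => P Q; lra.
apply: (integral_ge_monomial _ _ _ _ _ _ _ t0 iG IG) => x /andP[x0 xt].
have xT : 0 <= x <= T by rewrite x0 (le_trans xt).
have := GX x; rewrite x0 xt => /(_ isT) /ler_normlP[g1 _].
have ceq : C m * eps <= q.
  apply: le_trans (_ : C' * eps <= _).
    by rewrite ler_pM2r // /C'; have := ler_norm (C m); lra.
  by rewrite mulrC -ler_pdivlMr.
have b1 := ler_wpM2l (a_ge0 (m - 1)) (h1 isT x xT).
have b2 := ler_wpM2l (a_ge0 (m + 1)) (h2 isT x xT).
have b3 := ler_wpM2r (ltW q0) (a_le (m - 1)).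
have b4 := ler_wpM2r (ltW q0) (a_le (m + 1)).
rewrite !mulrBr in b1 b2.
have -> : (a (m - 1) * c + a (m + 1) * d) * x ^+ i =
  a (m - 1) * (c * x ^+ i) + a (m + 1) * (d * x ^+ i) by ring.
lra.
Qed.

(* Starting from [- D], each application of [asymp_ge_step] integrates once. *)
Lemma asymp_ge_neg (j : nat) : 0 <= D -> forall m,
  asymp_ge m (fun t => (- D * (2 * A) ^+ j / j`!%:R) * t ^+ j).
Proof.
move=> D0.
have A0 : 0 <= A := le_trans (a_ge0 0) (a_le 0).
elim: j => [|j IH] m.
  move=> sigma s0; exists 1 => // eps X G _ [_ XD _] t tT.
  have := XD m t tT => /ler_normlP[].
  rewrite fact0 !expr0 divr1 !mulr1; lra.
apply: asymp_ge_weaken (asymp_ge_step m _ _ _ (IH _) (IH _)) => t /andP[t0 _].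
(* The initial value is nonnegative and is dropped. *)
apply: le_trans (_ : _ <= (a (m - 1) * (- D * (2 * A) ^+ j / j`!%:R) +
    a (m + 1) * (- D * (2 * A) ^+ j / j`!%:R)) / j.+1%:R * t ^+ j.+1) _; last first.
  by rewrite lerDr ler0n.
rewrite ler_wpM2r ?exprn_ge0 // -mulrDl.
have -> : - D * (2 * A) ^+ j.+1 / (j.+1)`!%:R =
   (2 * A) * (- D * (2 * A) ^+ j / j`!%:R) / j.+1%:R.
  rewrite factS natrM exprS.
  field.
  by rewrite nat1r !pnatr_eq0 /= -lt0n fact_gt0.
rewrite ler_wpM2r ?invr_ge0 ?ler0n //.
(* The common factor is nonpositive, so replacing the sum of the two rates by [2 * A] lowers the
   bound. *)
apply: ler_wnM2r.
  by rewrite !mulNr oppr_le0 divr_ge0 ?mulr_ge0 // exprn_ge0 // mulr_ge0.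
by have := a_le (m - 1); have := a_le (m + 1); lra.
Qed.

(** The bound of [asymp_ge_neg] is at least [- D * (2 * A * T) ^+ j / j!] on the time interval, and
    this tends to 0 with [j]. A fixed large [j] costs half of [sigma]; the other half pays for small
    [eps]. *)
Lemma asymp_ge0 m : 0 <= D -> asymp_ge m (fun=> 0).
Proof.
move=> D0 sigma s0.
have A0 : 0 <= A := le_trans (a_ge0 0) (a_le 0).
(* [D + 1] instead of [D] keeps the divisor positive when [D = 0]. *)
have /cvgrPdist_lt /(_ (sigma / (2 * (D + 1)))) := @cvg_exp_coeff R (2 * A * T).
case.
  by apply: divr_gt0 => //; lra.
move=> j _ /(_ j (leqnn j)); rewrite /= /exp_coeff /= sub0r normrN => jj.
have [e0 e00 He] := asymp_ge_neg j D0 m (sigma / 2) (divr_gt0 s0 (ltr0Sn _ _)).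
exists e0 => // eps X G He0 HX t tT.
apply: le_trans (He _ _ _ He0 HX t tT).
have /andP[t0 tT'] := tT.
have : D * ((2 * A * t) ^+ j / j`!%:R) <= sigma / 2.
  apply: le_trans (_ : D * ((2 * A * T) ^+ j / j`!%:R) <= _).
    rewrite ler_wpM2l // ler_wpM2r ?invr_ge0 // lerXn2r ?nnegrE ?mulr_ge0 ?(ltW T0)//.
    by rewrite ler_wpM2l // mulr_ge0.
  move: jj; rewrite ger0_norm; last first.
    by rewrite divr_ge0 // exprn_ge0 // !mulr_ge0 // ltW.
  rewrite ltr_pdivlMr ?mulr_gt0 //; last by lra.
  set q := _ / _ => qq.
  have q0 : 0 <= q by rewrite /q divr_ge0 // exprn_ge0 // !mulr_ge0 // ltW.
  nra.
rewrite exprMn.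
set u := D * _.
have -> : - D * (2 * A) ^+ j / j`!%:R * t ^+ j = - u by rewrite /u; ring.
lra.
Qed.

Hypothesis alpha_ge0 : 0 <= alpha.
Hypothesis alpha0 : alpha <= a 0.
Hypothesis alpha1 : alpha <= a 1.

(** The mass bounces between the sites 0 and 1, gaining a factor [alpha * t / i] at the [i]-th step.
    The neighbour outside this pair is bounded below by 0 thanks to [asymp_ge0]. *)
Lemma asymp_ge_growth (i : nat) : 0 <= D ->
  asymp_ge (odd i)%:Z (fun t => alpha ^+ i / i`!%:R * t ^+ i).
Proof.
move=> D0.
have Z m : asymp_ge m (fun t => 0 * t ^+ i).
  by apply: asymp_ge_weaken (asymp_ge0 m D0) => t _; rewrite mul0r.
elim: i Z => [|i IH] Z.
  have Z0 m : asymp_ge m (fun t => 0 * t ^+ 0) by exact: Z.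
  (* With both neighbours bounded by 0, only the initial value 1 at site 0 survives. *)
  apply: asymp_ge_weaken (asymp_ge_step 0 _ _ _ (Z0 _) (Z0 _)) => t _.
  by rewrite !mulr0 addr0 !mul0r addr0 expr0 fact0 divr1 mulr1.
have Zi m : asymp_ge m (fun t => 0 * t ^+ i).
  by apply: asymp_ge_weaken (asymp_ge0 m D0) => t _; rewrite mul0r.
have {}IH := IH Zi.
have key b : alpha <= b -> forall t, 0 <= t ->
   alpha ^+ i.+1 / (i.+1)`!%:R * t ^+ i.+1 <=
   b * (alpha ^+ i / i`!%:R) / i.+1%:R * t ^+ i.+1.
  move=> ab t t0; rewrite ler_wpM2r ?exprn_ge0 //.
  have -> : alpha ^+ i.+1 / (i.+1)`!%:R = alpha * (alpha ^+ i / i`!%:R) / i.+1%:R.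
    rewrite factS natrM exprS; field.
    by rewrite nat1r !pnatr_eq0 /= -lt0n fact_gt0.
  by rewrite ler_wpM2r ?invr_ge0 ?ler0n // ler_wpM2r // divr_ge0 // exprn_ge0.
(* From an odd [i], site 1 feeds site 0 at rate [a 1]; from an even [i], site 0 feeds site 1 at rate
   [a 0]. *)
rewrite /=; case: (odd i) IH => /= IH.
- apply: asymp_ge_weaken (asymp_ge_step 0 0 _ _ (Zi _) IH) => t /andP[t0 _].
  rewrite eqxx mulr0 !add0r.
  by apply: le_trans (key _ alpha1 t t0) _; rewrite lerDr.
- apply: asymp_ge_weaken (asymp_ge_step 1 _ 0 _ IH (Zi _)) => t /andP[t0 _].
  rewrite mulr0 addr0 /= add0r subrr.
  exact: key.
Qed.

(** Evaluation at time [T]: the growth at site [odd i] must respect the a priori bound [D], and the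
    o(1) disappears because chains exist for arbitrarily small [eps]. *)
Lemma chain_growth_le : 0 <= D ->
  (forall eps : R, 0 < eps <= 1 -> exists X G, perturbed_chain eps X G) ->
  forall i : nat, (alpha * T) ^+ i / i`!%:R <= D.
Proof.
move=> D0 H i; apply/ler_addgt0Pr => e e0.
have [e1 e10 He] := asymp_ge_growth i D0 e e0.
have [|X [G HX]] := H (Num.min e1 1).
  by rewrite lt_min e10 ltr01 ge_min lexx orbT.
have TT : 0 <= T <= T by rewrite lexx ltW.
have e1P : 0 < Num.min e1 1 <= e1 by rewrite lt_min e10 ltr01 ge_min lexx.
have := He (Num.min e1 1) X G e1P HX T TT.
have [_ XD _] := HX.
have /ler_normlP[_] := XD (odd i)%:Z T TT.
have -> : (alpha * T) ^+ i / i`!%:R = alpha ^+ i / i`!%:R * T ^+ i.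
  by rewrite exprMn mulrAC.
move: (_ / _ * _) => P; lra.
Qed.

End perturbed_chain.

(** * Lattice sums and Sobolev norms *)

Section lattice_sums.
Variable R : realType.
Implicit Types (g : Z2 -> R) (k p q : Z2).

(** The index square of [sqsum] as one duplicate-free sequence, which turns the nested sums into a
    single big operator. *)
Definition window (N : nat) : seq Z2 :=
  [seq (i%:Z - N%:Z, j%:Z - N%:Z) | i <- iota 0 (2 * N).+1, j <- iota 0 (2 * N).+1].

Lemma sqsumE g N : sqsum g N = \sum_(p <- window N) g p.
Proof.
rewrite /window big_allpairs_dep /sqsum -(big_mkord xpredT (fun i : nat =>
  \sum_(j < (2 * N).+1) g (i%:Z - N%:Z, j%:Z - N%:Z))) /index_iota subn0.
by apply: eq_bigr => i _; rewrite -(big_mkord xpredT (fun j : nat =>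
  g (i%:Z - N%:Z, j%:Z - N%:Z))) /index_iota subn0.
Qed.

Lemma window_uniq N : uniq (window N).
Proof.
apply: allpairs_uniq; rewrite ?iota_uniq // => -[i j] [i' j'] _ _ [].
by move=> /addIr [->] /addIr [->].
Qed.

Lemma window_mem k N : (`|k.1|%N <= N)%N -> (`|k.2|%N <= N)%N -> k \in window N.
Proof.
case: k => k1 k2 /= h1 h2; apply/allpairsP.
exists (`|(k1 + N%:Z)%R|%N, `|(k2 + N%:Z)%R|%N).
by split; [rewrite mem_iota /=; lia | rewrite mem_iota /=; lia | congr pair => /=; lia].
Qed.

Lemma sum_seq_two g p q (u : seq Z2) : uniq u -> p \in u -> q \in u -> p != q ->
  (forall k, k != p -> k != q -> g k = 0) -> \sum_(k <- u) g k = g p + g q.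
Proof.
move=> uu pu qu pq g0; rewrite (bigD1_seq p) //= //=.
rewrite -big_filter (bigD1_seq q) ?filter_uniq ?mem_filter ?qu 1?eq_sym ?pq //=.
by rewrite big_filter_cond big1 ?addr0 // => k /andP[kp kq]; exact: g0.
Qed.

(** Serves the interaction with the shear, which has two modes: the square sums are eventually
    constant. *)
Lemma sqsum_two g p q : p != q -> (forall k, k != p -> k != q -> g k = 0) ->
  exists N0, forall N, (N0 <= N)%N -> sqsum g N = g p + g q.
Proof.
move=> pq g0; exists (maxn (maxn `|p.1| `|p.2|) (maxn `|q.1| `|q.2|)) => N.
rewrite !geq_max => /andP[/andP[? ?] /andP[? ?]].
by rewrite sqsumE; apply: sum_seq_two; rewrite ?window_uniq ?window_mem.
Qed.

Lemma sum_seq_le_esum g (u : seq Z2) : uniq u ->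
  ((\sum_(k <- u) g k)%:E <= \esum_(k in [set: Z2]) (g k)%:E)%E.
Proof.
move=> uu; apply: esum_ge; exists [set` u]; first by split=> //; exact: finite_seq.
by rewrite -fsbig_seq // sumEFin.
Qed.

Lemma esum_two g p q : p != q -> (forall k, 0 <= g k) ->
  (forall k, k != p -> k != q -> g k = 0) ->
  (\esum_(k in [set: Z2]) (g k)%:E = (g p + g q)%:E)%E.
Proof.
move=> pq gge0 g0.
have -> : (\esum_(k in [set: Z2]) (g k)%:E = \esum_(k in [set` [:: p; q]]) (g k)%:E)%E.
  rewrite [RHS]esum_mkcond; apply: eq_esum => k _; case: ifPn => //.
  rewrite notin_setE /= !inE => /negP; rewrite negb_or => /andP[kp kq].
  by rewrite g0.
rewrite (esum_fset (finite_seq _)); last by move=> k _; rewrite lee_fin.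
by rewrite -fsbig_seq /= ?inE ?pq // !big_cons big_nil adde0.
Qed.

End lattice_sums.

Section sobolev_norms.
Variable R : realType.
Implicit Types (f g h : coef R) (k p q : Z2) (s : R).

Lemma ksq_ge0 k : 0 <= ksq R k.
Proof. by rewrite addr_ge0 // sqr_ge0. Qed.

Definition Hs_term s f k : R := (1 + ksq R k) `^ s * ((f k).1 ^+ 2 + (f k).2 ^+ 2).

Lemma Hs_term_ge0 s f k : 0 <= Hs_term s f k.
Proof. by rewrite mulr_ge0 ?powR_ge0 // addr_ge0 // sqr_ge0. Qed.

Lemma Hs_norm2_ge0 s f : (0 <= Hs_norm2 s f)%E.
Proof. by apply: esum_ge0 => k _; rewrite lee_fin Hs_term_ge0. Qed.

(** [fine] sends an infinite value to 0, so [Hs_norm] reflects the sum only when the latter is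
    finite. *)
Lemma Hs_norm2_fineK s f : (Hs_norm2 s f < +oo)%E ->
  Hs_norm2 s f = (Hs_norm s f ^+ 2)%:E.
Proof.
move=> foo; rewrite /Hs_norm sqr_sqrtr ?fine_ge0 ?Hs_norm2_ge0 // fineK //.
by rewrite ge0_fin_numE // Hs_norm2_ge0.
Qed.

Lemma sum_Hs_term_le s f (u : seq Z2) : (Hs_norm2 s f < +oo)%E -> uniq u ->
  \sum_(k <- u) Hs_term s f k <= Hs_norm s f ^+ 2.
Proof.
move=> foo uu; rewrite -lee_fin -Hs_norm2_fineK //.
exact: sum_seq_le_esum.
Qed.

(** The hypotheses on [h] cover sums and differences alike, through (a ± b)^2 <= 2 (a^2 + b^2). *)
Lemma Hs_norm2_quasi_triangle s f g h :
  (forall k, (h k).1 ^+ 2 <= 2 * ((f k).1 ^+ 2 + (g k).1 ^+ 2)) ->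
  (forall k, (h k).2 ^+ 2 <= 2 * ((f k).2 ^+ 2 + (g k).2 ^+ 2)) ->
  (Hs_norm2 s h <= (Hs_norm2 s f + Hs_norm2 s f) + (Hs_norm2 s g + Hs_norm2 s g))%E.
Proof.
move=> h1 h2; rewrite /Hs_norm2.
rewrite -!esumD; try by move=> k _; rewrite ?adde_ge0 // lee_fin Hs_term_ge0.
apply: le_esum => k _; rewrite -!EFinD lee_fin.
have := h1 k; have := h2 k; have := powR_ge0 (1 + ksq R k) s.
rewrite -!mulrDr => p0 a2 a1; apply: ler_wpM2l => //; lra.
Qed.

Lemma in_Hs_csub s f g : in_Hs s f -> in_Hs s g -> in_Hs s (csub f g).
Proof.
move=> [rf ff] [rg fg]; split.
  move=> k; rewrite /csub /=; have [-> ->] := rf k; have [-> ->] := rg k.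
  by split=> //; ring.
apply: le_lt_trans (Hs_norm2_quasi_triangle s f g _ _ _) _.
- by move=> k /=; have := sqr_ge0 ((f k).1 + (g k).1); nra.
- by move=> k /=; have := sqr_ge0 ((f k).2 + (g k).2); nra.
- by rewrite !lte_add_pinfty.
Qed.

Lemma Hs_norm2_two s f p q : p != q ->
  (forall k, k != p -> k != q -> f k = (0, 0)) ->
  Hs_norm2 s f = (Hs_term s f p + Hs_term s f q)%:E.
Proof.
move=> pq f0; apply: (esum_two _ (Hs_term s f)) => // [k|k kp kq].
  exact: Hs_term_ge0.
by rewrite /Hs_term f0 //= expr0n /= addr0 mulr0.
Qed.

End sobolev_norms.
Arguments Hs_term {R}.

(** * The nonlinearity near the shear *)

Lemma ksq_ge1 (R : realType) (k : Z2) : k != (0, 0) -> 1 <= ksq R k.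
Proof.
case: k => k1 k2 k0; rewrite /ksq /kx /ky /=.
have : (1 <= k1 ^+ 2 + k2 ^+ 2)%R.
  have [k10|k10] := eqVneq k1 0; have [k20|k20] := eqVneq k2 0; try nia.
  by rewrite k10 k20 eqxx in k0.
by rewrite -(ler_int R) rmorphD !rmorphXn.
Qed.

Section nonlinearity.
Variables (R : realType) (beta : R).
Implicit Types (f : coef R) (k j : Z2) (n : nat) (m : int).

Lemma ksq_powR_le1 k : beta < 2 -> k != (0, 0) -> ksq R k `^ ((beta - 2) / 2) <= 1.
Proof.
move=> b2 k0; have e0 : (beta - 2) / 2 <= 0 by lra.
by have := ler_powR (ksq_ge1 _ _ k0) e0; rewrite powRr0.
Qed.

(** A crude bound: |j|^(beta - 2) is replaced by 1, which leaves at most |j|^2 in each component of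
    the symbol. *)
Lemma msym_bound (x y : R) j : beta < 2 ->
  `|x * (msym beta j).1 + y * (msym beta j).2| <= (`|x| + `|y|) * (1 + ksq R j).
Proof.
move=> b2; rewrite /msym; case: eqVneq => [_|j0] /=.
  rewrite !mulr0 addr0 normr0; apply: mulr_ge0; apply: addr_ge0 => //.
  exact: ksq_ge0.
have p1 := ksq_powR_le1 _ b2 j0; have p0 := powR_ge0 (ksq R j) ((beta - 2) / 2).
move: p1 p0; set P := _ `^ _ => p1 p0.
have a1 : `|kx R j * ky R j * P| <= 1 + ksq R j.
  rewrite normrM (ger0_norm p0) -[leRHS]mulr1 ler_pM //.
  rewrite /ksq normrM -[kx R j ^+ 2]real_normK ?num_real // -[ky R j ^+ 2]real_normK ?num_real //.
  have := normr_ge0 (kx R j); have := normr_ge0 (ky R j).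
  move: `|_| `|_| => u v; nra.
have a2 : `|- kx R j ^+ 2 * P| <= 1 + ksq R j.
  rewrite normrM (ger0_norm p0) -[leRHS]mulr1 ler_pM //.
  rewrite normrN ger0_norm ?sqr_ge0 // /ksq.
  have := sqr_ge0 (kx R j); have := sqr_ge0 (ky R j).
  lra.
apply: le_trans (ler_normD _ _) _; rewrite !(normrM x) !(normrM y) mulrDl.
by rewrite lerD // ler_wpM2l.
Qed.

(* AM-GM on the products of coefficients; r >= 2 absorbs the symbol into the
   Sobolev weight. *)
Lemma nl_re_bound (r : R) f k j : beta < 2 -> 2 <= r ->
  `|nl_re beta f k j| <= (`|k.1%:~R| + `|k.2%:~R|) *
     ((Hs_term r f j + Hs_term r f (k.1 - j.1, k.2 - j.2)%R) / 2).
Proof.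
move=> b2 r2; rewrite /nl_re /=.
set b := f (_, _).
rewrite normrM normrN.
have hb := msym_bound k.1%:~R k.2%:~R j b2.
apply: le_trans (ler_wpM2r (normr_ge0 _) hb) _.
rewrite -mulrA ler_wpM2l ?addr_ge0 //.
have w0 := ksq_ge0 R j.
have wr : (1 + ksq R j) ^+ 2 <= (1 + ksq R j) `^ r.
  rewrite -powR_mulrn; last by lra.
  by apply: ler_powR => //; lra.
have vr : 1 <= (1 + ksq R (k.1 - j.1, k.2 - j.2)%R) `^ r.
  have v0 := ksq_ge0 R (k.1 - j.1, k.2 - j.2)%R.
  have v1 : 1 <= 1 + ksq R (k.1 - j.1, k.2 - j.2)%R by lra.
  have r0 : 0 <= r by lra.
  by have := ler_powR v1 r0; rewrite powRr0.
rewrite /Hs_term -/b.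
move: wr vr; set W := _ `^ r; set V := (_ `^ r); move: (1 + ksq R j) => w wr vr.
have s1 := sqr_ge0 (f j).1; have s2 := sqr_ge0 (f j).2.
have s3 := sqr_ge0 b.1; have s4 := sqr_ge0 b.2.
(* The whole weight [w] of the symbol is put on the factor [f j]; the squares below give AM-GM for
   both signs. *)
apply: le_trans (_ : (w ^+ 2 * ((f j).1 ^+ 2 + (f j).2 ^+ 2) + (b.1 ^+ 2 + b.2 ^+ 2)) / 2 <= _).
  have p1 := sqr_ge0 (w * (f j).1 + b.2); have p2 := sqr_ge0 (w * (f j).2 + b.1).
  have p3 := sqr_ge0 (w * (f j).1 - b.2); have p4 := sqr_ge0 (w * (f j).2 - b.1).
  by case: ger0P => _; nra.
rewrite ler_wpM2r // lerD //; first by rewrite ler_wpM2r ?addr_ge0.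
by rewrite ler_peMl ?addr_ge0.
Qed.

(** Both j and k - j run through distinct modes, so each half of the termwise bound sums to at most
    the squared norm, uniformly in [N]. *)
Lemma sqsum_nl_re_bound (r : R) f k N : beta < 2 -> 2 <= r ->
  (Hs_norm2 r f < +oo)%E ->
  `|sqsum (nl_re beta f k) N| <= (`|k.1%:~R| + `|k.2%:~R|) * Hs_norm r f ^+ 2.
Proof.
move=> b2 r2 foo; rewrite sqsumE.
apply: le_trans (ler_norm_sum _ _ _) _.
apply: le_trans (ler_sum _ (fun j _ => nl_re_bound r f k j b2 r2)) _.
rewrite -mulr_sumr ler_wpM2l ?addr_ge0 // -mulr_suml big_split /=.
have u1 := sum_Hs_term_le _ r f _ foo (window_uniq N).
have : uniq [seq (k.1 - j.1, k.2 - j.2)%R | j : Z2 <- window N].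
  rewrite map_inj_uniq ?window_uniq // => -[a b] [c d] /= [].
  by move=> /addrI /oppr_inj -> /addrI /oppr_inj ->.
move=> /(sum_Hs_term_le _ r f _ foo); rewrite big_map /=.
lra.
Qed.

(* 2 sin(x_2) *)
Definition shear : coef R := fun k =>
  if k == (0, 1) then (0, -1) else if k == (0, -1) then (0, 1) else (0, 0).

(* 2 q cos(n x_1) *)
Definition wave n (q : R) : coef R := fun k =>
  if (k == (n%:Z, 0)) || (k == (- n%:Z, 0)) then (q, 0) else (0, 0).

Definition datum n (q : R) : coef R := fun k =>
  ((shear k).1 + (wave n q k).1, (shear k).2 + (wave n q k).2).

Lemma shear_off k : k.1 != 0 -> shear k = (0, 0).
Proof. by case: k => k1 k2 /= k0; rewrite /shear !xpair_eqE (negbTE k0). Qed.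

(** The symbol carries a factor j_1: a density depending on x_2 alone induces no velocity, which
    makes the shear stationary. *)
Lemma msym_axis j : j.1 = 0 -> msym beta j = (0, 0).
Proof.
by rewrite /msym /kx => ->; case: ifP => // _; rewrite mul0r expr0n /= oppr0 !mul0r.
Qed.

Lemma msym_dot_shear (x y : R) j :
  (x * (msym beta j).1 + y * (msym beta j).2) * (shear j).1 = 0 /\
  (x * (msym beta j).1 + y * (msym beta j).2) * (shear j).2 = 0.
Proof.
have [j0|j0] := eqVneq j.1 0.
  by rewrite msym_axis //= !mulr0 addr0 !mul0r.
by rewrite shear_off //= !mulr0.
Qed.

Lemma nl_shear k j : nl_re beta shear k j = 0 /\ nl_im beta shear k j = 0.
Proof.
rewrite /nl_re /nl_im /=; have [] := msym_dot_shear k.1%:~R k.2%:~R j.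
set c := (_ + _) => c1 c2.
by split; rewrite ?mulrN ?mulrDr ?mulrN !mulrA c1 c2 !mul0r; ring.
Qed.

(** The rate a_m at which the mode (n, m) feeds its neighbours (n, m - 1) and (n, m + 1). *)
Definition coupling n m : R :=
  kx R (n%:Z, m) ^+ 2 * ksq R (n%:Z, m) `^ ((beta - 2) / 2).

Lemma coupling_ge0 n m : 0 <= coupling n m.
Proof. by rewrite mulr_ge0 ?sqr_ge0 ?powR_ge0. Qed.

Lemma coupling_le n m : beta < 2 -> (0 < n)%N -> coupling n m <= n%:R ^+ 2.
Proof.
move=> b2 n0; rewrite /coupling -[leRHS]mulr1 ler_wpM2l ?sqr_ge0 //.
apply: ksq_powR_le1 => //; rewrite xpair_eqE negb_and; apply/orP; left.
by rewrite -lt0n in n0 *; lia.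
Qed.

(** With f = shear + h, the velocity comes from h alone. Its action on the shear involves only the
    two modes with k - j = (0, 1) or (0, -1), and as the shear coefficients are imaginary, the real
    parts of h form a closed chain. *)
Lemma sqsum_nl_re_linearize f n m : (0 < n)%N ->
  exists N0, forall N, (N0 <= N)%N ->
  sqsum (nl_re beta f (n%:Z, m)) N =
  sqsum (nl_re beta (csub f shear) (n%:Z, m)) N -
  (coupling n (m - 1) * (csub f shear (n%:Z, (m - 1)%R)).1 +
   coupling n (m + 1) * (csub f shear (n%:Z, (m + 1)%R)).1).
Proof.
move=> n0; set h := csub f shear.
(* The linear term: the shear transported by the velocity of [h]. *)
pose L j := (n%:~R * (msym beta j).1 + m%:~R * (msym beta j).2) *
   (- ((h j).1 * (shear (n%:Z - j.1, m - j.2)).2 + (h j).2 * (shear (n%:Z - j.1, m - j.2)).1)).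
have E j : nl_re beta f (n%:Z, m) j = nl_re beta h (n%:Z, m) j + L j.
  rewrite /nl_re /L /h /csub /=; have [] := msym_dot_shear n%:~R m%:~R j.
  set c := (_ + _); set b := f (_, _); set sb := shear (_, _).
  move=> c1 c2.
  transitivity (c * (- ((f j).1 * b.2 + (f j).2 * b.1)) + (c * (shear j).1) * b.2 + (c * (shear j).2) * b.1).
    by rewrite c1 c2; ring.
  ring.
have pq : (n%:Z, (m - 1)%R) != (n%:Z, (m + 1)%R) :> Z2.
  by rewrite xpair_eqE eqxx /=; lia.
have L0 j : j != (n%:Z, (m - 1)%R) -> j != (n%:Z, (m + 1)%R) -> L j = 0.
  case: j => j1 j2; rewrite !xpair_eqE => h1 h2; rewrite /L /shear /= !xpair_eqE.
  case: ifPn => [|_]; first by move=> /andP[a b]; lia.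
  case: ifPn => [|_]; first by move=> /andP[a b]; lia.
  by rewrite /= !mulr0 addr0 oppr0 mulr0.
have nz m' : ((n%:Z, m') == (0, 0) :> Z2) = false.
  by rewrite xpair_eqE; lia.
have Lm : L (n%:Z, (m - 1)%R) = - (coupling n (m - 1) * (h (n%:Z, (m - 1)%R)).1).
  rewrite /L /msym nz /= subrr (_ : m - (m - 1) = 1); last by lia.
  rewrite /shear /= /coupling /kx /ky /=.
  rewrite rmorphB /=; ring.
have Lp : L (n%:Z, (m + 1)%R) = - (coupling n (m + 1) * (h (n%:Z, (m + 1)%R)).1).
  rewrite /L /msym nz /= subrr (_ : m - (m + 1) = -1); last by lia.
  rewrite /shear /= /coupling /kx /ky /=.
  rewrite rmorphD /=; ring.
have [N0 HN] := sqsum_two _ _ _ _ pq L0.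
exists N0 => N /HN; rewrite Lm Lp => HL.
rewrite opprD -HL !sqsumE -big_split /=.
by apply: eq_bigr => j _; exact: E.
Qed.

(** The bound on the quadratic part is uniform in the truncation, so the resulting two-sided bound
    passes to the limit of the square sums of [f]. *)
Lemma NLre_linearize (r : R) f n m : beta < 2 -> (0 < n)%N -> 2 <= r ->
  in_Hs r (csub f shear) -> cvgn (sqsum (nl_re beta f (n%:Z, m))) ->
  `|- NLre beta f (n%:Z, m) -
    (coupling n (m - 1) * (csub f shear (n%:Z, (m - 1)%R)).1 +
     coupling n (m + 1) * (csub f shear (n%:Z, (m + 1)%R)).1)|
  <= (n%:R + `|m%:~R|) * Hs_norm r (csub f shear) ^+ 2.
Proof.
move=> b2 n0 r2 [_ hoo] cv.
have [N0 HN] := sqsum_nl_re_linearize f n m n0.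
set lin := _ + _ in HN *; set bnd := _ * _ ^+ 2.
have HB N : (N0 <= N)%N -> - lin - bnd <= sqsum (nl_re beta f (n%:Z, m)) N <= - lin + bnd.
  move=> NN; rewrite (HN _ NN).
  have := sqsum_nl_re_bound r (csub f shear) (n%:Z, m) N b2 r2 hoo.
  rewrite /= (@ger0_norm _ (n%:~R)) ?ler0n // -/bnd => /ler_normlP[].
  by move=> ? ?; apply/andP; split; lra.
have h1 : - lin - bnd <= NLre beta f (n%:Z, m).
  by apply: limr_ge => //; exists N0 => // N /= /HB /andP[].
have h2 : NLre beta f (n%:Z, m) <= - lin + bnd.
  by apply: limr_le => //; exists N0 => // N /= /HB /andP[].
by apply/ler_normlP; split; lra.
Qed.

(** With uniqueness, this identifies the second solution given by well-posedness as constant in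
    time. *)
Lemma shear_stationary (r T : R) : in_Hs r shear ->
  sipm_solution beta r T shear (fun=> shear).
Proof.
move=> hs.
have z1 k : sqsum (nl_re beta shear k) = fun=> 0.
  by apply/funext => N; rewrite sqsumE big1 // => j _; case: (nl_shear k j).
have z2 k : sqsum (nl_im beta shear k) = fun=> 0.
  by apply/funext => N; rewrite sqsumE big1 // => j _; case: (nl_shear k j).
have n1 k : NLre beta shear k = 0 by rewrite /NLre z1; apply: lim_cst.
have n2 k : NLim beta shear k = 0 by rewrite /NLim z2; apply: lim_cst.
split=> //; split; first by exists (Hs_norm r shear).
move=> k t _; rewrite n1 n2 z1 z2 !subrr integral0.
split; first by move=> tau _; split; apply: is_cvg_cst.
by split; [exact: integrable0|split; [exact: integrable0|]].
Qed.

End nonlinearity.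
Arguments shear {R}.
Arguments wave {R}.
Arguments datum {R}.

(** * Ill-posedness *)

Section data.
Variable R : realType.
Implicit Types (n : nat) (s q : R).

Lemma in_Hs_shear s : in_Hs s (@shear R).
Proof.
split.
  move=> [k1 k2]; rewrite /shear /= !xpair_eqE oppr_eq0.
  have e1 : (- k2 == 1) = (k2 == - 1) by exact: eqr_oppLR.
  have e2 : (- k2 == - 1) = (k2 == 1) by exact: eqr_opp.
  rewrite e1 e2.
  case: (k1 == 0) => /=; last by rewrite oppr0.
  have [->|k2n] := eqVneq k2 1; first by rewrite /= opprK.
  by case: eqVneq => /= _; rewrite ?oppr0.
rewrite (@Hs_norm2_two _ _ _ (0, 1) (0, -1)) ?ltry //.
by move=> k k1 k2; rewrite /shear (negbTE k1) (negbTE k2).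
Qed.

Lemma Hs_norm2_wave s n q : (0 < n)%N ->
  Hs_norm2 s (wave n q) = (2 * (1 + n%:R ^+ 2) `^ s * q ^+ 2)%:E.
Proof.
move=> n0; rewrite (@Hs_norm2_two _ _ _ (n%:Z, 0) (- n%:Z, 0)).
- rewrite /Hs_term /wave !eqxx orbT /= /ksq /kx /ky /= mulrNz sqrrN.
  by rewrite expr0n /= !addr0; congr EFin; ring.
- by rewrite xpair_eqE; lia.
- by move=> k k1 k2; rewrite /wave (negbTE k1) (negbTE k2).
Qed.

Lemma in_Hs_datum s n q : (0 < n)%N -> in_Hs s (datum n q).
Proof.
move=> n0; have [rs fs] := in_Hs_shear s; split.
  move=> k; have [r1 r2] := rs k; rewrite /datum /= r1 r2.
  have -> : wave n q (- k.1, - k.2)%R = wave n q k.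
    case: k {r1 r2} => k1 k2; rewrite /wave /= !xpair_eqE.
    by congr (if _ then _ else _); lia.
  have -> : (wave n q k).2 = 0 by rewrite /wave; case: ifP.
  by rewrite !addr0.
apply: le_lt_trans (Hs_norm2_quasi_triangle _ s shear (wave n q) _ _ _) _.
- by move=> k /=; have := sqr_ge0 ((shear k).1 - (wave n q k).1); nra.
- by move=> k /=; have := sqr_ge0 ((shear k).2 - (wave n q k).2); nra.
- by rewrite Hs_norm2_wave // !lte_add_pinfty // ltry.
Qed.

(** The bound is the same for all [n] and [q], so that by monotonicity T and K can be frozen at a
    single pair of norms. *)
Lemma Hs_norm_datum_le s n q : (0 < n)%N ->
  Hs_norm s (wave n q) <= 1 ->
  Hs_norm s (datum n q) <= Num.sqrt (2 * Hs_norm s (@shear R) ^+ 2 + 2).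
Proof.
move=> n0 w1; have [_ fs] := in_Hs_shear s.
have fw : (Hs_norm2 s (wave n q) < +oo)%E by rewrite Hs_norm2_wave // ltry.
have [_ fd] := in_Hs_datum s n q n0.
have w0 : 0 <= Hs_norm s (wave n q) by rewrite sqrtr_ge0.
rewrite -[leLHS]ger0_norm ?sqrtr_ge0 // -sqrtr_sqr ler_wsqrtr //.
have : (Hs_norm2 s (datum n q) <= (Hs_norm2 s shear + Hs_norm2 s shear) +
    (Hs_norm2 s (wave n q) + Hs_norm2 s (wave n q)))%E.
  apply: Hs_norm2_quasi_triangle.
  - by move=> k /=; have := sqr_ge0 ((shear k).1 - (wave n q k).1); nra.
  - by move=> k /=; have := sqr_ge0 ((shear k).2 - (wave n q k).2); nra.
rewrite (Hs_norm2_fineK _ _ _ fd) (Hs_norm2_fineK _ _ _ fs) (Hs_norm2_fineK _ _ _ fw).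
rewrite -!EFinD lee_fin.
have : Hs_norm s (wave n q) ^+ 2 <= 1 by rewrite expr_le1.
lra.
Qed.

Lemma wave_column n q (m : int) : (0 < n)%N -> (wave n q (n%:Z, m)).1 = q * (m == 0)%:R.
Proof.
move=> n0; have nn : (n%:Z == - n%:Z) = false by lia.
rewrite /wave !xpair_eqE nn eqxx /= orbF.
by case: (m == 0); rewrite /= ?mulr1 ?mulr0.
Qed.

Lemma csub_datum_shear n q : csub (datum n q) shear = wave n q.
Proof.
apply/funext => k; rewrite /csub /datum /=.
by case: (wave n q k) (shear k) => [a b] [c d] /=; congr pair; ring.
Qed.

End data.

Lemma norm_re_coef_le (R : realType) (r : R) (f : coef R) k : 0 <= r ->
  (Hs_norm2 r f < +oo)%E -> `|(f k).1| <= Hs_norm r f.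
Proof.
move=> r0 foo; have n0 : 0 <= Hs_norm r f by rewrite sqrtr_ge0.
rewrite -(@ler_pXn2r _ 2) ?nnegrE //= real_normK ?num_real //.
have := sum_Hs_term_le _ r f [:: k] foo isT; rewrite big_seq1.
apply: le_trans; rewrite /Hs_term.
have k0 := ksq_ge0 R k.
have k1 : 1 <= 1 + ksq R k by lra.
have := ler_powR k1 r0; rewrite powRr0 => p1.
have := sqr_ge0 (f k).1; have := sqr_ge0 (f k).2; nra.
Qed.

(** * Perturbed chains from well-posedness, and the size of their rates *)

Section wellposed.
Variables (R : realType) (beta r s : R).

(** The Lipschitz estimate against the stationary shear becomes the a priori bound of the chain. [T]
    and [K] are chosen before [n]; only the error constants [C] and the square root depend on
    [n]. *)
Lemma wellposed_perturbed_chain : beta < 2 -> 2 < r -> loc_lip_wellposed beta r s ->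
  exists T K : R, [/\ 0 < T, 0 < K &
    forall n : nat, (0 < n)%N -> exists C : int -> R,
    forall eps, 0 < eps <= 1 -> exists X G,
      perturbed_chain R T (K * Num.sqrt (2 * (1 + n%:R ^+ 2) `^ s))
        (coupling R beta n) C eps X G].
Proof.
move=> b2 r_gt2 [T [K [_ [Tpos [Tmon [_ [Kpos [Kmon WP]]]]]]]].
pose a0 := Hs_norm s (@shear R).
pose b0 := Num.sqrt (2 * a0 ^+ 2 + 2).
have a00 : 0 <= a0 by rewrite sqrtr_ge0.
have b00 : 0 <= b0 by rewrite sqrtr_ge0.
exists (T b0 a0), (K b0 a0); split; [exact: Tpos|exact: Kpos|] => n n0.
set S := Num.sqrt (2 * _).
have Ps : 0 < (1 + n%:R ^+ 2) `^ s :> R by rewrite powR_gt0 // ltr_pwDl // sqr_ge0.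
have S0 : 0 < S by rewrite sqrtr_gt0 mulr_gt0.
have Ks0 := Kpos _ _ b00 a00.
(* The quadratic error is (n + |m|) (K eps)^2, and division by q = eps / S leaves this constant
   times [eps]. *)
exists (fun m => (n%:R + `|m%:~R|) * K b0 a0 ^+ 2 * S) => eps /andP[eps0 eps1].
(* [S] is the H^s norm of the wave of amplitude 1, so the perturbation has norm exactly [eps]. *)
pose q := eps / S.
have q0 : 0 < q by rewrite divr_gt0.
have wq : Hs_norm s (wave n q) = eps.
  rewrite /Hs_norm Hs_norm2_wave //=.
  have -> : 2 * (1 + n%:R ^+ 2) `^ s * q ^+ 2 = eps ^+ 2.
    rewrite /q exprMn exprVn [S ^+ 2]sqr_sqrtr ?mulr_ge0 ?powR_ge0 //.
    by rewrite mulrCA mulfV ?mulr1 // gt_eqF // mulr_gt0.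
  by rewrite sqrtr_sqr ger0_norm // ltW.
have db : Hs_norm s (datum n q) <= b0 by apply: Hs_norm_datum_le => //; rewrite wq.
have d0 : 0 <= Hs_norm s (datum n q) by rewrite sqrtr_ge0.
have [rho [rho2 [solr [_ [_ [uniq2 lip]]]]]] :=
  WP (datum n q) shear (in_Hs_datum _ s n q n0) (in_Hs_shear _ s).
have TT : T b0 a0 <= T (Hs_norm s (datum n q)) a0.
  by apply: Tmon; rewrite ?d0 ?db ?a00 ?lexx.
have KK : K (Hs_norm s (datum n q)) a0 <= K b0 a0.
  by apply: Kmon; rewrite ?d0 ?db ?a00 ?lexx.
have [rho0 [[M rhoM] rhoI]] := solr.
have inT t : 0 <= t <= T b0 a0 -> 0 <= t <= T (Hs_norm s (datum n q)) a0.
  by move=> /andP[-> tT]; rewrite (le_trans tT).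
pose h t := csub (rho t) shear.
have hHs t : 0 <= t <= T b0 a0 -> in_Hs r (h t).
  by move=> /inT/rhoM[hr _]; apply: in_Hs_csub => //; exact: in_Hs_shear.
have hle t : 0 <= t <= T b0 a0 -> Hs_norm r (h t) <= K b0 a0 * eps.
  move=> /inT tT; have := lip t tT.
  rewrite -(uniq2 (fun=> shear) (shear_stationary _ _ _ _ (in_Hs_shear _ _)) t tT).
  rewrite csub_datum_shear wq => /le_trans; apply.
  by rewrite ler_wpM2r // ltW.
exists (fun m t => (h t (n%:Z, m)).1 / q), (fun m t => - NLre beta (rho t) (n%:Z, m) / q).
split.
- move=> m; rewrite /h rho0 csub_datum_shear wave_column // mulrC mulKf //.
  by rewrite gt_eqF.
- move=> m t tT; have [_ foo] := hHs t tT.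
  rewrite normrM normfV (gtr0_norm q0) ler_pdivrMr //.
  have r0 : 0 <= r by lra.
  apply: le_trans (norm_re_coef_le _ r (h t) (n%:Z, m) r0 foo) _.
  apply: le_trans (hle t tT) _.
  by rewrite /q -mulrA [S * _]mulrCA mulfV ?mulr1 // gt_eqF.
- move=> m t tT; have [cv [iR [_ [IR _]]]] := rhoI (n%:Z, m) t (inT t tT).
  have EG : (fun x => (- NLre beta (rho x) (n%:Z, m) / q)%:E) =
      (fun x => (- q^-1)%:E * (NLre beta (rho x) (n%:Z, m))%:E)%E.
    by apply/funext => x; rewrite -EFinM mulNr mulrC mulNr.
  split.
  + by rewrite EG; exact: integrableZl.
  + rewrite EG integralZl // IR -EFinM; congr EFin.
    by rewrite /h /csub /=; ring.
  + move=> x /andP[x0 xt].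
    have xT : 0 <= x <= T b0 a0 by rewrite x0 (le_trans xt) //; case/andP: tT.
    have [|cvx _] := cv x; first by rewrite x0.
    have r2 : 2 <= r by rewrite ltW.
    have := NLre_linearize R beta r (rho x) n m b2 n0 r2 (hHs x xT) cvx.
    rewrite -/(h x) => NB.
    rewrite [X in `|X|](_ : _ = (- NLre beta (rho x) (n%:Z, m) -
       (coupling R beta n (m - 1) * (h x (n%:Z, (m - 1)%R)).1 +
        coupling R beta n (m + 1) * (h x (n%:Z, (m + 1)%R)).1)) / q); last by ring.
    rewrite normrM normfV (gtr0_norm q0) ler_pdivrMr //.
    apply: le_trans NB _.
    have -> : (n%:R + `|m%:~R|) * K b0 a0 ^+ 2 * S * eps * q =
       (n%:R + `|m%:~R|) * (K b0 a0 * eps) ^+ 2.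
      by rewrite /q; field; rewrite gt_eqF.
    rewrite ler_wpM2l ?addr_ge0 // lerXn2r ?nnegrE ?sqrtr_ge0 //; last exact: hle.
    by rewrite mulr_ge0 // ltW.
Qed.

(** Here n^2 >= (1 + n^2) / 2, and n^2 + m^2 <= 1 + n^2 is raised to a negative power; the two
    factors recombine to the exponent beta / 2. *)
Lemma coupling_ge (n : nat) (m : int) : beta < 2 -> (0 < n)%N -> (`|m| <= 1)%N ->
  (1 + n%:R ^+ 2) `^ (beta / 2) / 2 <= coupling R beta n m.
Proof.
move=> b2 n0 m1; rewrite /coupling /kx /=.
have nR : 1 <= n%:R :> R by rewrite ler1n.
have k1 : 1 <= ksq R (n%:Z, m).
  by apply: ksq_ge1; apply/eqP => -[]; lia.
have k2 : ksq R (n%:Z, m) <= 1 + n%:R ^+ 2.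
  rewrite /ksq /kx /ky /= addrC lerD2r.
  have : (m ^+ 2 <= 1)%R by nia.
  by rewrite -(ler_int R) rmorphXn.
have P0 : 0 < 1 + n%:R ^+ 2 :> R by rewrite ltr_pwDl // sqr_ge0.
have -> : beta / 2 = 1 + (beta - 2) / 2 by field.
rewrite powRD; last by apply/implyP => _; rewrite gt_eqF.
rewrite powRr1 ?(ltW P0) // mulrAC; apply: ler_pM.
- by rewrite divr_ge0 // ltW.
- exact: powR_ge0.
- rewrite -[n%:~R]/(n%:R); nra.
- have e0 : 0 <= - ((beta - 2) / 2).
    by lra.
  rewrite -[(beta - 2) / 2]opprK powRN [leRHS]powRN lef_pV2 ?posrE ?powR_gt0 //; last by lra.
  by apply: ge0_ler_powR => //; rewrite nnegrE; lra.
Qed.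

End wellposed.

Theorem theorem2p4 (R : realType) (beta r s : R) :
  0 < beta < 2 -> 2 < r -> r + 1 <= s ->
  ~ loc_lip_wellposed beta r s.
Proof.
move=> /andP[b0 b2] r2 rs WP.
have [T [K [T0 K0 H]]] := wellposed_perturbed_chain R beta r s b2 r2 WP.
(* With P = 1 + n^2, the growth is of order P^(beta i / 2) against a bound of order P^(s / 2); [i]
   is chosen, before [n], to gain a full factor P. *)
have [i Hi] : exists i : nat, s / 2 + 1 <= beta / 2 * i%:R.
  exists (Num.bound ((s / 2 + 1) / (beta / 2))).
  have c0 : 0 <= (s / 2 + 1) / (beta / 2) by apply: divr_ge0; lra.
  have := ltW (archi_boundP c0).
  rewrite ler_pdivrMr; last by lra.
  by rewrite [_ * (beta / 2)]mulrC.
pose c := (T / 2) ^+ i / i`!%:R.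
have c0 : 0 < c.
  by rewrite divr_gt0 ?exprn_gt0 ?divr_gt0 // ltr0n fact_gt0.
have bnd0 : 0 <= 2 * K / c by apply: divr_ge0; [apply: mulr_ge0 => //|]; exact: ltW.
(* The comparison will give P <= 2 K / c, with [c] independent of [n]; this [n] contradicts it, as n
   <= P. *)
pose n := (Num.bound (2 * K / c)).+1.
have nb : 2 * K / c < n%:R.
  by apply: lt_le_trans (archi_boundP bnd0) _; rewrite ler_nat.
have [C HC] := H n isT.
pose P : R := 1 + n%:R ^+ 2.
have P1 : 1 <= P by rewrite lerDl sqr_ge0.
have D0 : 0 <= K * Num.sqrt (2 * P `^ s) by rewrite mulr_ge0 ?sqrtr_ge0 // ltW.
have A0 : 0 <= P `^ (beta / 2) / 2 by rewrite divr_ge0 // powR_ge0.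
have := chain_growth_le R T _ (n%:R ^+ 2) (P `^ (beta / 2) / 2) (coupling R beta n) C T0
  (coupling_ge0 R beta n) (fun m => coupling_le R beta n m b2 isT) A0
  (coupling_ge R beta n 0 b2 isT isT) (coupling_ge R beta n 1 b2 isT isT) D0 HC i.
have -> : (P `^ (beta / 2) / 2 * T) ^+ i / i`!%:R = P `^ (beta / 2 * i%:R) * c.
  by rewrite [P `^ (beta / 2 * i%:R)]powRrM powR_mulrn ?powR_ge0 // /c -mulrA [2^-1 * T]mulrC exprMn mulrA.
have P0 : 0 <= P by lra.
have S2 : Num.sqrt (2 * P `^ s) <= 2 * P `^ (s / 2).
  have e0 : 0 <= 2 * P `^ (s / 2) by rewrite mulr_ge0 ?powR_ge0.
  rewrite -[leRHS]ger0_norm // -sqrtr_sqr ler_wsqrtr //.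
  have -> : P `^ s = (P `^ (s / 2)) ^+ 2.
    by rewrite -powR_mulrn ?powR_ge0 // -powRrM divfK // pnatr_eq0.
  by rewrite exprMn ler_wpM2r ?sqr_ge0 //; lra.
have Pi : P * P `^ (s / 2) <= P `^ (beta / 2 * i%:R).
  apply: le_trans (ler_powR P1 Hi).
  rewrite powRD; last by apply/implyP => _; rewrite gt_eqF //; lra.
  by rewrite powRr1 // mulrC.
have Q0 : 0 < P `^ (s / 2) by rewrite powR_gt0; lra.
move=> fin.
have : P * c <= 2 * K.
  rewrite -(ler_pM2r Q0).
  apply: le_trans (_ : P `^ (beta / 2 * i%:R) * c <= _).
    by rewrite mulrAC ler_wpM2r // ltW.
  apply: le_trans fin _.
  apply: le_trans (ler_wpM2l (ltW K0) S2) _.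
  by rewrite mulrA [K * 2]mulrC.
rewrite -ler_pdivlMr // => PK.
have : n%:R <= P.
  have n1 : 1 <= n%:R :> R by rewrite ler1n.
  by rewrite /P; nra.
by move=> nP; have := lt_le_trans nb (le_trans nP PK); rewrite ltxx.
Qed.
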